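(* Let $q$ be an odd prime power and let $\varphi\in\mathbb{F}_q(x)$ be a separable permutation rational function of degree $3$. Then: (1) $\varphi$ is equivalent to a rational function of the form $\frac{x^3+ax}{bx^2+1}$ with $a,b\in\mathbb{F}_q$, $b\neq0$. (2) For $a,b\in\mathbb{F}_q$ with $b\neq 0$, the rational function $\frac{x^3+ax}{bx^2+1}$ is a permutation rational function if and only if $-b$ is not a square in $\mathbb{F}_q$ and $ab=9$.
   Context: A permutation rational function is a $\varphi\in\mathbb{F}_q(x)$ inducing a bijection of $\mathbb{P}^1(\mathbb{F}_q)$. Writing $\varphi=f/g$ with $f,g$ coprime, $\varphi$ is separable if $f,g$ do not both lie in $\mathbb{F}_q[x^p]$ ($p$ the characteristic), and its degree is $\max(\deg f,\deg g)$. Let $\mathcal M=\{\frac{ax+b}{cx+d}: a,b,c,d\in\mathbb{F}_q,\ ad-bc\neq0\}$ be the Möbius transformations; two rational functions $\varphi,\psi$ of the same degree are equivalent if there exist $m_1,m_2\in\mathcal M$ with $m_1\circ\varphi\circ m_2=\psi$.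
   Formalization: In (2), ''is a permutation rational function'' is replaced by ''is a permutation rational function of degree 3''; this matters only when ab=1, where the function reduces to x/b, a degree-1 permutation, although ab=9 fails, so the literal equivalence is false there. *)

(* Defs.v *)
From HB Require Import structures.
From mathcomp Require Import all_boot all_order all_algebra all_field.

Set Implicit Arguments.
Unset Strict Implicit.
Unset Printing Implicit Defensive.

Import GRing.Theory.
Local Open Scope ring_scope.

Notation ratfun F := {fraction {poly F}}.

Section RationalFunctions.
Variable F : fieldType.
Implicit Types (f g : {poly F}) (phi psi m : ratfun F).

Definition ratfrac f g : ratfun F := tofrac f / tofrac g.

(* [repr] picks an arbitrary fraction representing phi, so the coprime pair
   below is canonical only up to a common nonzero scalar (ratfun_numdenP);
   the notions defined from it do not depend on that scalar. *)
Definition ratfun_num phi : {poly F} :=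
  let r := repr phi in \n_r %/ gcdp \n_r \d_r.
Definition ratfun_den phi : {poly F} :=
  let r := repr phi in \d_r %/ gcdp \n_r \d_r.

Definition ratfun_degree phi : nat :=
  maxn (size (ratfun_num phi)).-1 (size (ratfun_den phi)).-1.

(* P^1(F) is [option F], with None the point at infinity.  At infinity, the
   value of f/g is the ratio of the coefficients of 'X^d in f and g, where d
   is the degree of f/g: homogenize f and g in degree d and evaluate at
   [1 : 0]. *)
Definition proj_point (u v : F) : option F :=
  if v == 0 then None else Some (u / v).

Definition ratfun_eval phi (P : option F) : option F :=
  let f := ratfun_num phi in
  let g := ratfun_den phi in
  let d := ratfun_degree phi in
  if P is Some x then proj_point f.[x] g.[x] else proj_point f`_d g`_d.

Definition permutation_ratfun phi : Prop := bijective (ratfun_eval phi).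

Definition poly_in_Xp (p : nat) f : Prop := exists h : {poly F}, f = h \Po 'X^p.

(* p is meant to be the characteristic of F. *)
Definition ratfun_separable (p : nat) phi : Prop :=
  ~ (poly_in_Xp p (ratfun_num phi) /\ poly_in_Xp p (ratfun_den phi)).

Definition ratfun_const (c : F) : ratfun F := tofrac c%:P.

(* phi o psi = f(psi) / g(psi) in F(x), where phi = f/g.  When psi is not
   constant, g(psi) is nonzero and this is the usual composition; x / 0 = 0 is
   involved only for psi a constant pole of phi. *)
Definition ratfun_comp phi psi : ratfun F :=
  (map_poly ratfun_const (ratfun_num phi)).[psi]
    / (map_poly ratfun_const (ratfun_den phi)).[psi].

Definition moebius m : Prop :=
  exists a b c d : F,
    a * d - b * c != 0 /\
    m = ratfrac (a *: 'X + b%:P) (c *: 'X + d%:P).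

Definition ratfun_equiv phi psi : Prop :=
  ratfun_degree phi = ratfun_degree psi /\
  exists m1 m2, moebius m1 /\ moebius m2 /\
    ratfun_comp m1 (ratfun_comp phi m2) = psi.

(* An element of F(x), so common factors cancel: for a * b = 1 it is x / b, a
   permutation of degree 1; it has degree 3 exactly when a * b != 1. *)
Definition cubic_ratfun (a b : F) : ratfun F :=
  ratfrac ('X^3 + a *: 'X) (b *: 'X^2 + 1).

Definition is_square (c : F) : Prop := exists y : F, y ^+ 2 = c.

Lemma ratfun_repr phi : phi = ratfrac \n_(repr phi) \d_(repr phi).
Proof.
have dn0 : \d_(repr phi) != 0 := denom_ratioP _.
rewrite -[LHS]reprK /ratfrac; unlock FracField.tofrac.
rewrite -[X in _ = _ * X]FracField.pi_inv -[RHS]FracField.pi_mul.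
congr (\pi_(FracField.type _))%qT.
rewrite /FracField.mulf /FracField.invf /= !numden_Ratio ?oner_neq0 //.
by rewrite mulr1 mul1r Ratio_numden.
Qed.

Lemma ratfun_den_neq0 phi : ratfun_den phi != 0.
Proof.
have dn0 : \d_(repr phi) != 0 := denom_ratioP _.
by rewrite /ratfun_den dvdp_div_eq0 ?dvdp_gcdr.
Qed.

Lemma ratfun_coprime phi : coprimep (ratfun_num phi) (ratfun_den phi).
Proof.
have dn0 : \d_(repr phi) != 0 := denom_ratioP _.
by apply: coprimep_div_gcd; rewrite dn0 orbT.
Qed.

Lemma ratfunE phi : phi = ratfrac (ratfun_num phi) (ratfun_den phi).
Proof.
rewrite [LHS]ratfun_repr /ratfun_num /ratfun_den.
set n := \n_ _; set d := \d_ _.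
have dn0 : d != 0 := denom_ratioP _.
apply/eqP; rewrite /ratfrac eqr_div ?tofrac_eq0 ?dvdp_div_eq0 ?dvdp_gcdr //.
rewrite -!tofracM tofrac_eq; apply/eqP.
have := divpK (dvdp_gcdr n d); have := divpK (dvdp_gcdl n d).
move: (gcdp n d) => g En Ed.
by rewrite -[LHS](congr1 (fun x => x * (d %/ g)) En) mulrAC -mulrA Ed.
Qed.

Lemma ratfun_numdenP f g : coprimep f g -> g != 0 ->
  exists2 c : F, c != 0 &
    ratfun_num (ratfrac f g) = c *: f /\ ratfun_den (ratfrac f g) = c *: g.
Proof.
move=> cfg g0; set phi := ratfrac f g.
have d0 := ratfun_den_neq0 phi; have cnd := ratfun_coprime phi.
have E : ratfun_num phi * g = ratfun_den phi * f.
  have := ratfunE phi; rewrite {1}/phi /ratfrac => /eqP.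
  rewrite eqr_div ?tofrac_eq0 // -!tofracM tofrac_eq => /eqP <-.
  exact: mulrC.
have gd : g %| ratfun_den phi.
  have cgf : coprimep g f by rewrite coprimep_sym.
  by rewrite -(Gauss_dvdpl _ cgf) -E dvdp_mulIr.
have dg : ratfun_den phi %| g.
  have cdn : coprimep (ratfun_den phi) (ratfun_num phi) by rewrite coprimep_sym.
  by rewrite -(Gauss_dvdpr _ cdn) E dvdp_mulIl.
have /eqpfP : ratfun_den phi %= g by rewrite /eqp dg gd.
set c := lead_coef (ratfun_den phi) / lead_coef g => Ed.
exists c; first by rewrite mulf_neq0 ?invr_eq0 ?lead_coef_eq0.
split=> //; apply: (mulIf g0).
by rewrite E Ed -!scalerAl mulrC.
Qed.

End RationalFunctions.

(* Main.v *)
(** Let D = -b be a nonsquare and c = a b. On F the function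
    (x^3 + a x) / (b x^2 + 1) equals (x + (c - 1) x / (b x^2 + 1)) / b, so if it
    permutes F then the sums over F of x^2 and of
    (x + (c - 1) x / (b x^2 + 1))^2 agree. The sums over F of 1 / (b x^2 + 1)
    and of 1 / (b x^2 + 1)^2 are 1/2 and 3/8, by expanding in powers of D x^2,
    and the equality of sums of squares becomes (c - 1) (c - 9) = 0. Conversely,
    if c = 9, a coincidence of values at x <> y gives
    (b x y - 3)^2 = -b (x - y)^2, so -b is a square.

    For the normal form of phi = f/g, consider for each u the member
    h_u = g(u) f - f(u) g of the pencil spanned by f and g. If h_0, h_1 and
    h_(-1) were all multiples of (X - u)^3, their linear dependency would force
    characteristic 3, and then f and g would be polynomials in X^3. So some u
    is not totally ramified; sending u and phi(u) to infinity makes the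
    denominator an irreducible quadratic, which can be centred as B z^2 + 1,
    and a linear combination removes the z^2 term of the numerator. The constant
    term C of z^3 + A z + C vanishes too: the sum over F of the values is 0, and
    it is C times the sum of 1 / (B z^2 + 1), namely C/2. *)

Require Import Defs.
From mathcomp Require Import all_boot all_order all_algebra all_field ring zify.

Set Implicit Arguments.
Unset Strict Implicit.
Unset Printing Implicit Defensive.

Import GRing.Theory.
Local Open Scope ring_scope.

(** * Power sums over a finite field of odd order q *)

Section PowerSums.
Variable F : finFieldType.
Implicit Types (b D x y : F) (i k n : nat).

Lemma natr_card : #|F|%:R = 0 :> F.
Proof.
have /eqP : \sum_(x : F) x = \sum_(x : F) (x + 1) := reindex_inj (addIr 1).
rewrite big_split /= -[X in X == _]addr0 => /eqP/addrI/esym.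
by rewrite sumr_const.
Qed.

(** For k > 0, ['X^k - 1] has at most k < q - 1 roots, so some nonzero a has a^k <> 1; substituting
    a x for x multiplies the sum by a^k. *)
Lemma power_sum_lt k : (k < #|F|.-1)%N -> \sum_(x : F) x ^+ k = 0.
Proof.
case: k => [_|k lt_k].
  by under eq_bigr do rewrite expr0; rewrite sumr_const natr_card.
have [a a0 ak] : exists2 a : F, a != 0 & a ^+ k.+1 != 1.
  apply/exists_inP; apply: contraLR lt_k.
  rewrite negb_exists -leqNgt => /forallP a1.
  have s : size ('X^(k.+1) - 1%:P : {poly F}) = k.+2 by rewrite size_XnsubC.
  have p0 : 'X^(k.+1) - 1%:P != 0 :> {poly F} by rewrite -size_poly_eq0 s.
  have := @max_poly_roots F _ (enum [pred x : F | x != 0]) p0.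
  rewrite s -cardE -(@cardC1 _ (0 : F)); apply; last exact: enum_uniq.
  apply/allP => x; rewrite mem_enum inE => x0.
  have := a1 x; rewrite x0 negbK => /eqP xk.
  by rewrite rootE !hornerE xk subrr.
have /eqP : \sum_(x : F) x ^+ k.+1 = a ^+ k.+1 * \sum_(x : F) x ^+ k.+1.
  rewrite mulr_sumr; under [RHS]eq_bigr do rewrite -exprMn.
  exact: reindex_inj (mulfI a0).
rewrite -subr_eq0 -{1}[X in X - _]mul1r -mulrBl mulf_eq0.
by rewrite subr_eq0 eq_sym (negPf ak) => /eqP.
Qed.

Lemma expf_card_pred x : x ^+ #|F|.-1 = (x != 0)%:R.
Proof.
have q1 := finNzRing_gt1 F.
have [->|x0] := eqVneq; first by rewrite expr0n -subn1 subn_eq0 leqNgt q1.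
by apply: (mulfI x0); rewrite mulr1 -exprS prednK ?expf_card // ltnW.
Qed.

Lemma power_sum_card : \sum_(x : F) x ^+ #|F|.-1 = -1.
Proof.
have e x : x ^+ #|F|.-1 = 1 - (x == 0)%:R.
  by rewrite expf_card_pred; case: (x == 0); rewrite ?subrr ?subr0.
under eq_bigr do rewrite e.
rewrite sumrB sumr_const natr_card sub0r -natr_sum.
by rewrite (bigD1 0) //= eqxx big1 // => i /negPf ->.
Qed.

Hypothesis oddF : odd #|F|.
Local Notation n := #|F|./2.

Lemma cardE_half : #|F|.-1 = n.*2.
Proof. by rewrite -[in LHS](odd_double_half #|F|) oddF. Qed.

Lemma half_card_gt0 : (0 < n)%N.
Proof. by rewrite -double_gt0 -cardE_half -subn1 subn_gt0 finNzRing_gt1. Qed.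

Lemma natr_half : 2 * n%:R = -1 :> F.
Proof.
apply/eqP; rewrite -subr_eq0 opprK -natrM mul2n -cardE_half natr1.
by rewrite prednK ?natr_card // ltnW // finNzRing_gt1.
Qed.

Lemma odd_char_neq0 : 2 != 0 :> F.
Proof.
apply/eqP => two0; have := natr_half; rewrite two0 mul0r => /esym/eqP.
by rewrite oppr_eq0 oner_eq0.
Qed.

Lemma power_sum_even i : (i < #|F|.-1)%N ->
  \sum_(x : F) x ^+ 2 ^+ i = - (i == n)%:R.
Proof.
move=> lt_i; under eq_bigr do rewrite -exprM mul2n.
have [->|ne_in] := eqVneq; first by rewrite -cardE_half power_sum_card.
rewrite oppr0; have [lt_in|le_ni] := ltnP i n.
  by apply: power_sum_lt; rewrite cardE_half ltn_double.
have lt_ni : (n < i)%N by rewrite ltn_neqAle eq_sym ne_in.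
(* Here 2 i >= q, so x^q = x lowers the exponent to 2 i - q + 1, which is below q - 1. *)
pose k := (i.*2 - #|F|).+1.
have E : i.*2 = (#|F| + k.-1)%N.
  by rewrite subnKC // -(odd_double_half #|F|) oddF add1n ltn_double.
transitivity (\sum_(x : F) x ^+ k).
  by apply: eq_bigr => x _; rewrite E exprD expf_card -exprS.
apply: power_sum_lt; move: lt_i E; rewrite /k /=; move: cardE_half; lia.
Qed.

(** Exponents 2 i range over 0, 2, ..., 2 (q - 2), and only 2 i = q - 1 has a nonzero power sum. *)
Lemma sum_even_poly (c : nat -> F) D :
  \sum_(x : F) \sum_(i < #|F|.-1) c i * (D * x ^+ 2) ^+ i = - (c n * D ^+ n).
Proof.
have lt_n : (n < #|F|.-1)%N.
  by rewrite cardE_half -addnn -[X in (X < _)%N]addn0 ltn_add2l half_card_gt0.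
rewrite exchange_big (bigD1 (Ordinal lt_n)) //=.
rewrite [X in _ + X]big1 ?addr0 => [|i ne_in].
  under eq_bigr do rewrite exprMn mulrA.
  by rewrite -mulr_sumr power_sum_even // eqxx mulrN1.
under eq_bigr do rewrite exprMn mulrA.
rewrite -mulr_sumr power_sum_even //.
by rewrite (negPf ne_in : (i == n :> nat) = _) oppr0 mulr0.
Qed.

Lemma geometric_sum (R : comNzRingType) (y : R) m :
  (1 - y) * (\sum_(i < m) y ^+ i) = 1 - y ^+ m.
Proof.
elim: m => [|m IH]; first by rewrite big_ord0; ring.
by rewrite big_ord_recr /= mulrDr IH !exprS -?natr1; ring.
Qed.

(** Truncated expansion of (1 - y)^(-2); [geometric_sum3] truncates that of 2 (1 - y)^(-3). *)
Lemma geometric_sum2 (R : comNzRingType) (y : R) m :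
  (1 - y) ^+ 2 * (\sum_(i < m) (i%:R + 1) * y ^+ i) =
    1 - (m%:R + 1) * y ^+ m + m%:R * y ^+ m.+1.
Proof.
elim: m => [|m IH]; first by rewrite big_ord0; ring.
by rewrite big_ord_recr /= mulrDr IH !exprS -?natr1; ring.
Qed.

Lemma geometric_sum3 (R : comNzRingType) (y : R) m :
  (1 - y) ^+ 3 * (\sum_(i < m) ((i%:R + 1) * (i%:R + 2)) * y ^+ i) =
    2 - (m%:R + 1) * (m%:R + 2) * y ^+ m + 2 * m%:R * (m%:R + 2) * y ^+ m.+1
      - m%:R * (m%:R + 1) * y ^+ m.+2.
Proof.
elim: m => [|m IH]; first by rewrite big_ord0; ring.
by rewrite big_ord_recr /= mulrDr IH !exprS -?natr1; ring.
Qed.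

Section Nonsquare.
Variable b : F.
Hypothesis b0 : b != 0.
Hypothesis b_irr : forall x, b * x ^+ 2 + 1 != 0.

Let D := - b.
Let D1 x : 1 - D * x ^+ 2 != 0.
Proof. by rewrite mulNr opprK addrC. Qed.

Let q1 : #|F|.-1.+1 = #|F|.
Proof. by rewrite prednK // ltnW // finNzRing_gt1. Qed.

Let card1 : #|F|.-1%:R = -1 :> F.
Proof. by rewrite cardE_half -mul2n natrM natr_half. Qed.

(** Euler's criterion. Put y = D x^2, which is never 1: the sum of y^i for i < q - 1 is the
    indicator of x = 0. Its sum over x is 1, and [sum_even_poly] evaluates that sum as - D^n. *)
Let D_half : D ^+ n = -1.
Proof.
have : \sum_(x : F) (1 - x ^+ #|F|.-1) =
    \sum_(x : F) \sum_(i < #|F|.-1) 1 * (D * x ^+ 2) ^+ i.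
  apply: eq_bigr => x _; under eq_bigr do rewrite mul1r.
  apply: (mulfI (D1 x)); rewrite geometric_sum.
  have -> : x ^+ #|F|.-1 = (D * x ^+ 2) ^+ #|F|.-1.
    by rewrite !expf_card_pred mulf_eq0 expf_eq0 oppr_eq0 (negPf b0).
  set y := D * _; have e := expf_card y; rewrite -q1 exprS in e.
  by rewrite mulrBr mulr1 mulrBl mul1r e; ring.
rewrite (sum_even_poly (fun=> 1)) sumrB power_sum_card sumr_const natr_card.
rewrite mul1r sub0r opprK.
by move=> ->; rewrite opprK.
Qed.

(** With m = q - 1, which is -1 in F, the y^m term of [geometric_sum2] vanishes and the right side
    is 1 - y^q = 1 - y, so the truncated series is exactly 1 / (1 - y). The coefficient at i = n is
    n + 1, and 2 n = -1. *)
Lemma sum_inv_quadratic : 2 * \sum_(x : F) (b * x ^+ 2 + 1)^-1 = 1.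
Proof.
have -> : \sum_(x : F) (b * x ^+ 2 + 1)^-1 =
    \sum_(x : F) \sum_(i < #|F|.-1) (i%:R + 1) * (D * x ^+ 2) ^+ i.
  apply: eq_bigr => x _; apply: (mulfI (expf_neq0 2 (D1 x))).
  rewrite geometric_sum2 card1 q1 expf_card.
  by have := b_irr x; rewrite /D => bx0; field.
rewrite (sum_even_poly (fun i => i%:R + 1)) D_half.
transitivity (2 * n%:R + 2 : F); first by ring.
by rewrite natr_half; ring.
Qed.

Lemma sum_inv_quadratic_sq : 8 * \sum_(x : F) (b * x ^+ 2 + 1) ^- 2 = 3.
Proof.
have -> : 8 * \sum_(x : F) (b * x ^+ 2 + 1) ^- 2 = 4 *
    \sum_(x : F) \sum_(i < #|F|.-1) ((i%:R + 1) * (i%:R + 2)) * (D * x ^+ 2) ^+ i.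
  rewrite !mulr_sumr; apply: eq_bigr => x _.
  apply: (mulfI (expf_neq0 3 (D1 x))).
  (* For m = -1 in F the right side of [geometric_sum3] is 2 - 2 y, so the series equals 2 / (1 -
     y)^2. *)
  rewrite [RHS]mulrCA geometric_sum3 card1 exprS q1 expf_card.
  by have := b_irr x; rewrite /D => bx0; field.
rewrite (sum_even_poly (fun i => (i%:R + 1) * (i%:R + 2))) D_half.
transitivity ((2 * n%:R + 2) * (2 * n%:R + 4) : F); first by ring.
by rewrite natr_half; ring.
Qed.

End Nonsquare.

End PowerSums.

(** * Evaluation on the projective line through coprime representatives *)

Section Ratfun.
Variable F : fieldType.
Implicit Types (f g : {poly F}) (phi psi : ratfun F) (P Q : option F).

(* The value at P of the form of degree d that f dehomogenizes. *)
Definition form_at (d : nat) f P : F := if P is Some x then f.[x] else f`_d.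

Lemma ratfun_evalE phi P :
  ratfun_eval phi P =
    proj_point (form_at (ratfun_degree phi) (ratfun_num phi) P)
               (form_at (ratfun_degree phi) (ratfun_den phi) P).
Proof. by case: P. Qed.

Lemma form_atZ d c f P : form_at d (c *: f) P = c * form_at d f P.
Proof. by case: P => [x|] /=; rewrite ?hornerZ ?coefZ. Qed.

Lemma form_atD d f g P : form_at d (f + g) P = form_at d f P + form_at d g P.
Proof. by case: P => [x|] /=; rewrite ?hornerD ?coefD. Qed.

Lemma proj_pointZ (c u v : F) : c != 0 ->
  proj_point (c * u) (c * v) = proj_point u v.
Proof.
by move=> c0; rewrite /proj_point mulf_eq0 (negPf c0) -mulf_div divff // mul1r.
Qed.

Lemma proj_point_cross (u v u' v' : F) : (u != 0) || (v != 0) ->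
  (u' != 0) || (v' != 0) ->
  proj_point u v = proj_point u' v' <-> u * v' = u' * v.
Proof.
rewrite /proj_point; have [->|v0] := eqVneq v; have [->|v'0] := eqVneq v'.
- by rewrite !mulr0.
- rewrite orbF mulr0 => u0 _; split=> // /eqP.
  by rewrite mulf_eq0 (negPf u0) (negPf v'0).
- rewrite orbF mulr0 => _ u0; split=> // /esym/eqP.
  by rewrite mulf_eq0 (negPf u0) (negPf v0).
- move=> _ _; split=> [[]|] /eqP; first by rewrite eqr_div // => /eqP.
  by rewrite -eqr_div // => /eqP ->.
Qed.

Local Notation ratfunC := (@tofrac {poly F} \o @polyC F).

Section Frac.
Variables f g : {poly F}.
Hypotheses (cfg : coprimep f g) (g0 : g != 0).

Lemma ratfun_degree_frac :
  ratfun_degree (ratfrac f g) = maxn (size f).-1 (size g).-1.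
Proof.
have [c c0 [Ef Eg]] := ratfun_numdenP cfg g0.
by rewrite /ratfun_degree Ef Eg !size_scale.
Qed.

Lemma ratfun_eval_frac d P : ratfun_degree (ratfrac f g) = d ->
  ratfun_eval (ratfrac f g) P = proj_point (form_at d f P) (form_at d g P).
Proof.
have [c c0 [Ef Eg]] := ratfun_numdenP cfg g0.
by rewrite ratfun_evalE => ->; rewrite Ef Eg !form_atZ proj_pointZ.
Qed.

Lemma ratfun_comp_frac psi :
  ratfun_comp (ratfrac f g) psi =
    (map_poly ratfunC f).[psi] / (map_poly ratfunC g).[psi].
Proof.
have [c c0 [Ef Eg]] := ratfun_numdenP cfg g0.
rewrite /ratfun_comp -![map_poly (@ratfun_const F)]/(map_poly ratfunC).
rewrite Ef Eg !map_polyZ !hornerZ -mulf_div divff ?mul1r //=.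
by rewrite tofrac_eq0 polyC_eq0.
Qed.

End Frac.

(** At a finite point coprimality excludes a common root; at infinity, the polynomial that attains
    the degree contributes its leading coefficient. *)
Lemma form_at_neq0 f g P : coprimep f g -> 
  let d := maxn (size f).-1 (size g).-1 in
  (form_at d f P != 0) || (form_at d g P != 0).
Proof.
move=> cfg /=; case: P => [x|] /=.
  have [fx|nfx] := boolP (root f x); last by rewrite -rootE nfx.
  by rewrite (coprimep_root cfg fx) orbT.
have f0g0 : (f != 0) || (g != 0).
  by rewrite -negb_and; apply: contraTN cfg => /andP[/eqP-> /eqP->];
     rewrite coprime0p eqp01.
have [le_gf|lt_fg] := leqP (size g).-1 (size f).-1; last first.
  rewrite -[g`_(size g).-1]/(lead_coef g) lead_coef_eq0 -size_poly_eq0.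
  by case: (size g) lt_fg => [|k _] /=; rewrite ?ltn0 ?orbT.
have [f0|f0] := eqVneq f 0; last first.
  by rewrite -[f`_(size f).-1]/(lead_coef f) lead_coef_eq0 f0.
move: f0g0 le_gf; rewrite f0 eqxx size_poly0 /= leqn0 coef0 eqxx /= => g0 /eqP <-.
by rewrite -[g`_(size g).-1]/(lead_coef g) lead_coef_eq0.
Qed.

Lemma ratfun_eval_inj phi : injective (ratfun_eval phi) <->
  forall P Q, let d := ratfun_degree phi in
    form_at d (ratfun_num phi) P * form_at d (ratfun_den phi) Q =
    form_at d (ratfun_num phi) Q * form_at d (ratfun_den phi) P -> P = Q.
Proof.
have nz P := form_at_neq0 P (ratfun_coprime phi).
split=> [inj P Q d E | inj P Q].
  by apply: inj; rewrite !ratfun_evalE; apply/proj_point_cross => //; exact: nz.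
by rewrite !ratfun_evalE => /proj_point_cross E; apply: inj; apply: E; exact: nz.
Qed.

End Ratfun.

Lemma permutation_ratfunP (F : finFieldType) (phi : ratfun F) :
  permutation_ratfun phi <-> injective (ratfun_eval phi).
Proof. by split=> [/bij_inj // | /injF_bij]. Qed.

(** * The family (x^3 + a x) / (b x^2 + 1), and sufficiency of the criterion *)

Section Cubic.
Variable F : fieldType.
Implicit Types a b : F.

Lemma size_cubic_num a : size ('X^3 + a *: 'X : {poly F}) = 4%N.
Proof.
rewrite size_polyDl ?size_polyXn // (leq_ltn_trans (size_scale_leq _ _)) //.
by rewrite size_polyX.
Qed.

Lemma size_cubic_den b : b != 0 -> size (b *: 'X^2 + 1 : {poly F}) = 3%N.
Proof. by move=> b0; rewrite size_polyDl size_scale ?size_polyXn // size_poly1. Qed.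

Lemma cubic_den_neq0 b : b *: 'X^2 + 1 != 0 :> {poly F}.
Proof.
apply/eqP => /(congr1 (coefp 0)) /eqP.
by rewrite /coefp !coefE /= mulr0 add0r oner_eq0.
Qed.

Lemma cubic_num_horner a x : ('X^3 + a *: 'X).[x] = x ^+ 3 + a * x.
Proof. by rewrite hornerD hornerZ hornerXn hornerX. Qed.

Lemma cubic_den_horner b x : (b *: 'X^2 + 1).[x] = b * x ^+ 2 + 1.
Proof. by rewrite hornerD hornerZ hornerXn -[1]/(1%:P) hornerC. Qed.

Lemma cubic_coprime a b : a * b != 1 ->
  coprimep ('X^3 + a *: 'X : {poly F}) (b *: 'X^2 + 1).
Proof.
move=> ab1.
have -> : 'X^3 + a *: 'X = 'X * ('X^2 + a%:P) :> {poly F}.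
  by rewrite -!mul_polyC; ring.
rewrite coprimepMl; apply/andP; split; apply/Bezout_coprimepP.
  exists (- (b *: 'X), 1) => /=.
  have -> : - (b *: 'X) * 'X + 1 * (b *: 'X^2 + 1) = 1 :> {poly F}; last exact: eqpxx.
  by rewrite -!mul_polyC; ring.
exists (- b%:P, 1) => /=.
have -> : - b%:P * ('X^2 + a%:P) + 1 * (b *: 'X^2 + 1) = (1 - a * b)%:P :> {poly F}.
  by rewrite polyCB polyCM -!mul_polyC; ring.
by rewrite polyC_eqp1 subr_eq0 eq_sym.
Qed.

Lemma cubic_degree a b : b != 0 ->
  ratfun_degree (cubic_ratfun a b) = 3%N <-> a * b != 1.
Proof.
move=> b0; split=> [|ab1]; last first.
  rewrite ratfun_degree_frac ?cubic_coprime ?cubic_den_neq0 //.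
  by rewrite size_cubic_num size_cubic_den.
apply: contra_eqN => /eqP ab1.
have -> : cubic_ratfun a b = ratfrac 'X b%:P.
  apply/eqP; rewrite eqr_div ?tofrac_eq0 ?cubic_den_neq0 ?polyC_eq0 //.
  rewrite -!tofracM tofrac_eq; apply/eqP; rewrite -!mul_polyC.
  transitivity (b%:P * 'X^3 + (a * b)%:P * 'X : {poly F}); first by rewrite polyCM; ring.
  by rewrite ab1; ring.
rewrite ratfun_degree_frac ?polyC_eq0 ?coprimepp //.
  by rewrite size_polyX size_polyC b0.
by rewrite -alg_polyC coprimepZr ?coprimep1.
Qed.

Lemma cubic_eval a b x : a * b != 1 -> b != 0 -> b * x ^+ 2 + 1 != 0 ->
  ratfun_eval (cubic_ratfun a b) (Some x) =
    Some ((x ^+ 3 + a * x) / (b * x ^+ 2 + 1)).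
Proof.
move=> ab1 b0 bx.
rewrite (@ratfun_eval_frac _ _ _ _ _ 3) ?cubic_coprime ?cubic_den_neq0 //;
  last exact/cubic_degree.
by rewrite /proj_point /= cubic_num_horner cubic_den_horner (negPf bx).
Qed.

Lemma cubic_eval_pole a b x : a * b != 1 -> b != 0 -> b * x ^+ 2 + 1 = 0 ->
  ratfun_eval (cubic_ratfun a b) (Some x) = None.
Proof.
move=> ab1 b0 bx.
rewrite (@ratfun_eval_frac _ _ _ _ _ 3) ?cubic_coprime ?cubic_den_neq0 //;
  last exact/cubic_degree.
by rewrite /proj_point /= cubic_den_horner bx eqxx.
Qed.

Lemma cubic_eval_infty a b : a * b != 1 -> b != 0 ->
  ratfun_eval (cubic_ratfun a b) None = None.
Proof.
move=> ab1 b0.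
rewrite (@ratfun_eval_frac _ _ _ _ _ 3) ?cubic_coprime ?cubic_den_neq0 //;
  last exact/cubic_degree.
by rewrite /proj_point /= !coefE /= mulr0 addr0 eqxx.
Qed.

(** A zero x gives (b x)^2 = -b; a square root y of -b gives the zero 1 / y. *)
Lemma nonsquare_irr b : b != 0 ->
  ~ is_square (- b) <-> (forall x, b * x ^+ 2 + 1 != 0).
Proof.
move=> b0; split=> [nsq x | irr [y y2]].
  apply/eqP => bx; apply: nsq; exists (b * x).
  transitivity (b * (b * x ^+ 2 + 1) - b); first by ring.
  by rewrite bx; ring.
have y0 : y != 0 by rewrite -sqrf_eq0 y2 oppr_eq0.
by have /eqP[] := irr y^-1; rewrite -[b]opprK -y2; field.
Qed.

Lemma cubic_ratfun_inj a b : 2 != 0 :> F -> b != 0 -> a * b = 9 ->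
  ~ is_square (- b) -> injective (ratfun_eval (cubic_ratfun a b)).
Proof.
move=> two0 b0 ab9 nsq; have irr := (nonsquare_irr b0).1 nsq.
have ab1 : a * b != 1.
  rewrite ab9 -subr_eq0 (_ : 9 - 1 = 2 ^+ 3 :> F); last by ring.
  by rewrite expf_neq0.
case=> [x|] [y|]; rewrite ?cubic_eval_infty ?cubic_eval //.
case=> /eqP; rewrite eqr_div // => /eqP E; congr Some; apply/eqP; rewrite -subr_eq0.
apply: contra_notT nsq => xy0.
(* The cross difference of the values at x and y is (x - y) G(a b). The product a b is a separate
   argument so that 9 can replace it. *)
pose G c := b * x ^+ 2 * y ^+ 2 + x ^+ 2 + y ^+ 2 + x * y - c * x * y + a.
have /eqP : (x - y) * G (a * b) = 0.
  by move/eqP: E; rewrite /G -subr_eq0 => /eqP <-; ring.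
rewrite mulf_eq0 (negPf xy0) ab9 /= => /eqP G0.
exists ((b * x * y - 3) / (x - y)).
have e : (b * x * y - 3) ^+ 2 = - b * (x - y) ^+ 2.
  apply/eqP; rewrite -subr_eq0; apply/eqP.
  transitivity (b * G 9 + (9 - a * b)); first by rewrite /G; ring.
  by rewrite G0 ab9; ring.
by rewrite expr_div_n e mulfK ?expf_neq0.
Qed.

End Cubic.

(** * Necessity of the criterion, by comparing sums of squares *)

Section CubicFinite.
Variable F : finFieldType.
Hypothesis oddF : odd #|F|.

Lemma sum_odd_eq0 (h : F -> F) : (forall x, h (- x) = - h x) -> \sum_x h x = 0.
Proof.
move=> oddh; have e : \sum_x h x = \sum_x h (- x) := reindex_inj oppr_inj.
apply: (mulfI (odd_char_neq0 oddF)); rewrite mulr0 mulr2n mulrDl mul1r.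
rewrite {1}e -big_split big1 // => x _.
by rewrite oddh /= addNr.
Qed.

Lemma cubic_ratfun_inj_cond (a b : F) : b != 0 -> a * b != 1 ->
  injective (ratfun_eval (cubic_ratfun a b)) ->
  ~ is_square (- b) /\ a * b = 9.
Proof.
move=> b0 ab1 inj.
(* A zero of the denominator would be a second preimage of infinity. *)
have irr x : b * x ^+ 2 + 1 != 0.
  apply/eqP => bx; suff : Some x = None by [].
  by apply: inj; rewrite cubic_eval_pole // cubic_eval_infty.
split; first exact/nonsquare_irr.
pose psi (x : F) := x + (a * b - 1) * (x / (b * x ^+ 2 + 1)).
have psi_inj : injective psi.
  move=> x y E; suff [//] : Some x = Some y.
  apply: inj; rewrite !cubic_eval //; congr Some; apply: (mulfI b0).
  have psiE z : psi z = b * ((z ^+ 3 + a * z) / (b * z ^+ 2 + 1)).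
    by rewrite /psi; have := irr z => bz; field.
  by rewrite -!psiE.
have two0 := odd_char_neq0 oddF.
have S1 := sum_inv_quadratic oddF b0 irr.
have S2 := sum_inv_quadratic_sq oddF b0 irr.
have : \sum_x x ^+ 2 = \sum_x psi x ^+ 2 by apply: reindex_inj.
(* Expand the square and write x^2 as (N - 1) / b, where N = b x^2 + 1. *)
have -> : \sum_x psi x ^+ 2 = \sum_x x ^+ 2 +
   (a * b - 1) / b * \sum_x (2 + (a * b - 3) * (b * x ^+ 2 + 1)^-1
                             - (a * b - 1) * (b * x ^+ 2 + 1) ^- 2).
  rewrite mulr_sumr -big_split; apply: eq_bigr => x _ /=.
  by rewrite /psi; have := irr x => bx; field; rewrite b0 bx.
rewrite -[X in X = _ -> _]addr0 => /addrI/esym/eqP.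
rewrite mulf_eq0 mulf_eq0 invr_eq0 subr_eq0 (negPf ab1) (negPf b0) /=.
rewrite sumrB big_split /= sumr_const -!mulr_sumr -[2 *+ _]mulr_natr.
move: S1 S2; set S1 := \sum_x _; set S2 := \sum_x _ => ES1 ES2.
rewrite natr_card mulr0 add0r => /eqP E.
apply/eqP; rewrite -subr_eq0; apply/eqP.
transitivity (8 * ((a * b - 3) * S1 - (a * b - 1) * S2)); last first.
  by rewrite E mulr0.
(* The two known sums turn this into 4 (a b - 3) - 3 (a b - 1) = a b - 9. *)
transitivity (4 * (a * b - 3) * (2 * S1) - (a * b - 1) * (8 * S2)).
  by rewrite ES1 ES2; ring.
by ring.
Qed.
End CubicFinite.

(** * Composition with Möbius maps *)

Lemma divf_cancel (K : fieldType) (x y z : K) : z != 0 -> x / z / (y / z) = x / y.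
Proof. by move=> z0; rewrite -mulf_div divff ?mulr1 // invr_eq0. Qed.

(** The forms Z^3 + a Z w^2 and w (b Z^2 + w^2) at Z = x / v, w = 1 / v. *)
Lemma cubic_dehomog (K : fieldType) (x v a b : K) : v != 0 ->
  (x / v) ^+ 3 + a * (x / v) * (1 / v) ^+ 2 = (x ^+ 3 + a * x) / v ^+ 3 /\
  1 / v * (b * (x / v) ^+ 2 + (1 / v) ^+ 2) = (b * x ^+ 2 + 1) / v ^+ 3.
Proof. by move=> v0; split; field. Qed.

Section Moebius.
Variable F : fieldType.
Implicit Types (a b c d e u x : F) (f g : {poly F}).
Local Notation ratfunC := (@tofrac {poly F} \o @polyC F).

Lemma moebius_coprime a b c d : a * d - b * c != 0 ->
  coprimep (a *: 'X + b%:P) (c *: 'X + d%:P).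
Proof.
move=> det; apply/Bezout_coprimepP; exists (- c%:P, a%:P) => /=.
have -> : - c%:P * (a *: 'X + b%:P) + a%:P * (c *: 'X + d%:P) = (a * d - b * c)%:P.
  by rewrite polyCB !polyCM -!mul_polyC; ring.
by rewrite polyC_eqp1.
Qed.

Lemma moebius_den_neq0 a b c d : a * d - b * c != 0 -> c *: 'X + d%:P != 0.
Proof.
apply: contra_neq => cd0.
have c0 : c = 0.
  by have /(congr1 (coefp 1)) := cd0; rewrite /coefp !coefE /= mulr1 addr0.
have d0 : d = 0.
  by have /(congr1 (coefp 0)) := cd0; rewrite /coefp !coefE /= mulr0 add0r.
by rewrite c0 d0 !mulr0 subrr.
Qed.

Lemma moebius_comp a b c d (N D : ratfun F) : a * d - b * c != 0 -> D != 0 ->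
  ratfun_comp (ratfrac (a *: 'X + b%:P) (c *: 'X + d%:P)) (N / D) =
  (ratfunC a * N + ratfunC b * D) / (ratfunC c * N + ratfunC d * D).
Proof.
move=> det D0.
rewrite ratfun_comp_frac ?moebius_coprime ?(moebius_den_neq0 det) //.
have ev (k l : F) : (map_poly ratfunC (k *: 'X + l%:P)).[N / D] =
   (ratfunC k * N + ratfunC l * D) / D.
  rewrite rmorphD /= map_polyZ map_polyX map_polyC hornerD hornerZ hornerX hornerC.
  by rewrite mulrDl mulfK // mulrA.
by rewrite (ev a) (ev c) divf_cancel.
Qed.

Lemma tofrac_div (f g h : {poly F}) : h != 0 ->
  tofrac f / tofrac h / (tofrac g / tofrac h) = ratfrac f g.
Proof. by move=> h0; rewrite divf_cancel ?tofrac_eq0. Qed.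

(* With [w = X - u] and [Z = 1 + e w], the Möbius map [z = Z / w] sends [u] to
   infinity; the hypotheses say that the pencil spanned by the numerator and
   the denominator of [phi] contains [z^3 + A z] and [B z^2 + 1], up to the
   common factor [w^3]. *)
Lemma equiv_of_pencil (phi : ratfun F) (al be ga de e u A B : F) :
  let w := 'X - u%:P in let Z := 1 + e%:P * w in
  al * de - be * ga != 0 -> B != 0 -> A * B != 1 -> ratfun_degree phi = 3%N ->
  al *: ratfun_num phi + be *: ratfun_den phi = Z ^+ 3 + A%:P * Z * w ^+ 2 ->
  ga *: ratfun_num phi + de *: ratfun_den phi = w * (B%:P * Z ^+ 2 + w ^+ 2) ->
  ratfun_equiv phi (cubic_ratfun A B).
Proof.
move=> w Z det B0 AB1 deg3 EN ED; split; first by rewrite deg3 (cubic_degree A B0).2.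
(* Inverse of z = Z / w: since z = e + 1 / w, the old variable is u + 1 / (z - e). *)
pose m2 := ratfrac (u *: 'X + (1 - u * e)%:P) (1 *: 'X + (- e)%:P).
have det2 : u * (- e) - (1 - u * e) * 1 != 0.
  by rewrite (_ : _ - _ = -1) ?oppr_eq0 ?oner_eq0 //; ring.
exists (ratfrac (al *: 'X + be%:P) (ga *: 'X + de%:P)), m2.
split; first by exists al, be, ga, de.
split; first by exists u, (1 - u * e), 1, (- e).
pose V : {poly F} := 'X - e%:P.
have V0 : V != 0 by rewrite polyXsubC_eq0.
have tV0 : tofrac V != 0 by rewrite tofrac_eq0.
(* Substitution of [m2]; it sends w to 1 / V and Z to X / V. *)
pose ev p := (map_poly ratfunC p).[m2].
have evD p q : ev (p + q) = ev p + ev q by rewrite /ev rmorphD hornerD.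
have evM p q : ev (p * q) = ev p * ev q by rewrite /ev rmorphM hornerM.
have evC c : ev c%:P = tofrac c%:P by rewrite /ev map_polyC hornerC.
have ev1 : ev 1 = 1 by rewrite /ev rmorph1 hornerC.
have evZ c p : ev (c *: p) = tofrac c%:P * ev p by rewrite -mul_polyC evM evC.
have evX n p : ev (p ^+ n) = ev p ^+ n.
  by elim: n => [|n IH]; rewrite ?expr0 ?ev1 // !exprS evM IH.
have evw : ev w = 1 / tofrac V.
  rewrite /w evD -polyCN evC /ev map_polyX hornerX /m2 /ratfrac.
  apply: (mulIf tV0).
  have -> : 1 *: 'X + (- e)%:P = V by rewrite scale1r polyCN.
  rewrite mulrDl !mulfVK // -tofracM -tofracD -[in RHS]tofrac1; congr tofrac.
  by rewrite /V polyCB polyCN polyCM -mul_polyC; ring.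
have evZZ : ev Z = tofrac 'X / tofrac V.
  rewrite /Z evD evM ev1 evC evw; apply: (mulIf tV0).
  rewrite mulrDl mulrA !mulfVK // mul1r mulr1 -tofracD; congr tofrac.
  by rewrite /V; ring.
have := congr1 ev EN; have := congr1 ev ED.
rewrite !(evD, evM, evZ, evX, evC, evw, evZZ) => ED' EN'.
have tV3 : tofrac (V ^+ 3) = tofrac V ^+ 3 by apply: rmorphXn.
have tN : tofrac ('X^3 + A *: 'X) =
    tofrac 'X ^+ 3 + tofrac A%:P * tofrac 'X :> ratfun F.
  rewrite -mul_polyC tofracD; congr (_ + _); [exact: rmorphXn | exact: rmorphM].
have tD : tofrac (B *: 'X^2 + 1) = tofrac B%:P * tofrac 'X ^+ 2 + 1 :> ratfun F.
  rewrite -mul_polyC tofracD tofrac1; congr (_ + _).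
  by rewrite [LHS]rmorphM; congr (_ * _); exact: rmorphXn.
have [hN hD] := cubic_dehomog (tofrac 'X) (tofrac A%:P) (tofrac B%:P) tV0.
rewrite -tV3 -tN in hN; rewrite -tV3 -tD in hD.
have EN2 := etrans EN' hN; have ED2 := etrans ED' hD.
have V30 : tofrac (V ^+ 3) != 0 by rewrite tV3 expf_neq0.
clear ED' EN' hN hD tN tD.
(* Otherwise both combinations are multiples of the image of the numerator, and comparing the
   coefficients of X^3 and 1 gives ga = al = 0, against [det]. *)
have D0 : ev (ratfun_den phi) != 0.
  apply/eqP => D0; move: EN2 ED2; rewrite D0 !mulr0 !addr0 => EN2 ED2.
  have : ga%:P * ('X^3 + A *: 'X) = al%:P * (B *: 'X^2 + 1) :> {poly F}.
    apply/eqP; rewrite -tofrac_eq !tofracM; apply/eqP.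
    apply: (mulIf (_ : (tofrac (V ^+ 3))^-1 != 0)); first
      by rewrite invr_eq0 tofrac_eq0 expf_neq0.
    by rewrite -!mulrA -EN2 -ED2; ring.
  move=> E; have ga0 : ga = 0.
    by have /(congr1 (coefp 3)) := E; rewrite /coefp !coefCM !coefE /=
      !(mulr0, addr0, mulr1).
  have al0 : al = 0.
    by have /(congr1 (coefp 0)) := E; rewrite /coefp !coefCM !coefE /=
      !(mulr0, add0r, addr0, mulr1).
  by move/eqP: det; rewrite ga0 al0; apply; ring.
rewrite [ratfun_comp phi m2]/(ev _ / ev _) moebius_comp //=.
by rewrite EN2 ED2 tofrac_div ?expf_neq0.
Qed.

End Moebius.

(** * Normal form of a pencil of cubics with a member vanishing only at u *)

Section Pencil.
Variable F : fieldType.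
Implicit Types (a b c d e u x : F) (f g h : {poly F}).

Lemma cubic_taylor h u : (size h <= 4)%N -> exists h1 h2 : F,
  h = (h.[u])%:P + h1%:P * ('X - u%:P) + h2%:P * ('X - u%:P) ^+ 2
      + (h`_3)%:P * ('X - u%:P) ^+ 3.
Proof.
move=> sh; exists (h`_1 + 2 * u * h`_2 + 3 * u ^+ 2 * h`_3), (h`_2 + 3 * u * h`_3).
have Eh : h = (h`_0)%:P + (h`_1)%:P * 'X + (h`_2)%:P * 'X ^+ 2 + (h`_3)%:P * 'X ^+ 3.
  have {1}-> : h = \poly_(i < 4) h`_i.
    by apply/polyP=> i; rewrite coef_poly; case: ltnP => // le4;
      rewrite nth_default ?(leq_trans sh).
  by rewrite poly_def !big_ord_recl big_ord0 /= -!mul_polyC; ring.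
have Eu : h.[u] = h`_0 + h`_1 * u + h`_2 * u ^+ 2 + h`_3 * u ^+ 3.
  rewrite {1}Eh !(hornerD, hornerCM, hornerXn, hornerX, hornerC); ring.
rewrite {1}Eh Eu; move: (h`_0) (h`_1) (h`_2) (h`_3) => a b c d.
by rewrite !(polyCD, polyCM, polyC_exp); ring.
Qed.

(** Cramer's rule recovers nonzero multiples of f and g, so h is a common divisor. *)
Lemma coprime_pencil_divisor f g h al be ga de :
  al * de - be * ga != 0 -> coprimep f g ->
  h %| al *: f + be *: g -> h %| ga *: f + de *: g -> size h = 1%N.
Proof.
move=> det /coprimepP cfg hN hD; apply/eqP; rewrite size_poly_eq1.
apply: cfg; rewrite -(dvdpZr _ _ det).
  have -> : (al * de - be * ga) *: f =
      de%:P * (al *: f + be *: g) - be%:P * (ga *: f + de *: g).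
    by rewrite -!mul_polyC polyCB !polyCM; ring.
  by rewrite dvdp_sub ?dvdp_mull.
have -> : (al * de - be * ga) *: g =
    al%:P * (ga *: f + de *: g) - ga%:P * (al *: f + be *: g).
  by rewrite -!mul_polyC polyCB !polyCM; ring.
by rewrite dvdp_sub ?dvdp_mull.
Qed.

Lemma pencil_normal_form f g u : 2 != 0 :> F ->
  (size f <= 4)%N -> (size g <= 4)%N -> (f.[u] != 0) || (g.[u] != 0) ->
  let h := g.[u] *: f - f.[u] *: g in
  h`_3 != 0 -> (forall x, x != u -> h.[x] != 0) ->
  (forall c, h != c *: ('X - u%:P) ^+ 3) ->
  exists al be ga de e A B C : F,
    let w := 'X - u%:P in let Z := 1 + e%:P * w in
    [/\ al * de - be * ga != 0, B != 0,
        al *: f + be *: g = Z ^+ 3 + A%:P * Z * w ^+ 2 + C%:P * w ^+ 3 &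
        ga *: f + de *: g = w * (B%:P * Z ^+ 2 + w ^+ 2)].
Proof.
move=> two0 sf sg fgu h h3 hx hc.
have sh : (size h <= 4)%N.
  rewrite (leq_trans (size_polyD _ _)) // geq_max size_polyN.
  by rewrite !(leq_trans (size_scale_leq _ _)).
have [h1 [h2]] := cubic_taylor u sh.
have -> : h.[u] = 0 by rewrite /h hornerD hornerN !hornerZ; ring.
rewrite polyC0 add0r; move: (h`_3) h3 => k3 k30; set w := 'X - _ => Eh.
have hE x : h.[x] = (x - u) * (h1 + h2 * (x - u) + k3 * (x - u) ^+ 2).
  by rewrite Eh /w !(hornerD, hornerN, hornerCM, horner_exp, hornerX, hornerC); ring.
(* If h1 = 0, then h is a multiple of w^3, or u - h2 / k3 is another root. *)
have h10 : h1 != 0.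
  apply/eqP => h10; have [h20|h20] := eqVneq h2 0.
    by have /eqP[] := hc k3; rewrite Eh h10 h20 !polyC0 -mul_polyC -/w; ring.
  have /eqP[] : h.[u - h2 / k3] != 0.
    by apply: hx; rewrite -subr_eq0 addrC addKr oppr_eq0 mulf_neq0 ?invr_eq0.
  by rewrite hE h10; field.
(* Completing the square: h = w (h1 (1 + e w)^2 + m w^2). If m were 0, u - 1 / e would be another
   root. *)
pose e := h2 / (2 * h1); pose m := k3 - h1 * e ^+ 2.
have Eh2 : h2 = 2 * h1 * e by rewrite /e; field; rewrite two0 h10.
have Ek3 : k3 = m + h1 * e ^+ 2 by rewrite /m; ring.
have m0 : m != 0.
  apply/eqP => m0; have e0 : e != 0.
    by apply: contra_neq k30; rewrite Ek3 m0 => ->; ring.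
  have /eqP[] : h.[u - e^-1] != 0.
    by apply: hx; rewrite -subr_eq0 addrC addKr oppr_eq0 invr_eq0.
  by rewrite hE Ek3 Eh2 m0; field.
clearbody m e.
have [al [be ab1]] : exists al be : F, al * f.[u] + be * g.[u] = 1.
  have [fu|fu] := eqVneq f.[u] 0.
    by exists 0, g.[u]^-1; rewrite mul0r add0r mulVf //; move: fgu; rewrite fu eqxx.
  by exists f.[u]^-1, 0; rewrite mul0r addr0 mulVf.
pose N := al *: f + be *: g.
have sN : (size N <= 4)%N.
  rewrite (leq_trans (size_polyD _ _)) // geq_max.
  by rewrite !(leq_trans (size_scale_leq _ _)).
have [n1 [n2]] := cubic_taylor u sN.
have -> : N.[u] = 1 by rewrite /N hornerD !hornerZ.
move: (N`_3) => n3; rewrite -/w polyC1 => EN.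
(* Subtracting k h from N makes its w coefficient 3 e, so that it has no Z^2 w term when written in
   Z and w. *)
pose k := (n1 - 3 * e) / h1.
have Ek : n1 = 3 * e + k * h1 by rewrite /k; field.
clearbody k.
(* The two members are N - k h and h / m; A and C are found by matching the coefficients of w^2 and
   w^3. *)
exists (al - k * g.[u]), (be + k * f.[u]), (g.[u] / m), (- f.[u] / m), e.
exists (3 * e ^+ 2 - 2 * e * n1 + n2), (h1 / m),
  (- e ^+ 3 + n1 * e ^+ 2 - n2 * e + n3 - k * m).
rewrite -/w; split.
- have -> : (al - k * g.[u]) * (- f.[u] / m) - (be + k * f.[u]) * (g.[u] / m)
     = - (al * f.[u] + be * g.[u]) / m by field.
  by rewrite ab1 mulf_neq0 ?invr_eq0 ?oppr_eq0 ?oner_eq0.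
- by rewrite mulf_neq0 ?invr_eq0.
- have -> : (al - k * g.[u]) *: f + (be + k * f.[u]) *: g = N - k *: h.
    by rewrite /N /h -!mul_polyC !(polyCB, polyCD, polyCM); ring.
  rewrite EN Eh Eh2 Ek3 Ek -mul_polyC.
  by rewrite !(polyCB, polyCD, polyCM, polyCN, polyC_exp, polyC1); ring.
have -> : (g.[u] / m) *: f + (- f.[u] / m) *: g = m^-1 *: h.
  by rewrite /h -!mul_polyC !(polyCB, polyCD, polyCM, polyCN); ring.
have mV : m^-1%:P * m%:P = 1 :> {poly F} by rewrite -polyCM mulVf ?polyC1.
rewrite Eh Eh2 Ek3 -mul_polyC !(polyCB, polyCD, polyCM, polyCN, polyC_exp).
transitivity (w * (h1%:P * m^-1%:P * (1 + e%:P * w) ^+ 2 + (m^-1%:P * m%:P) * w ^+ 2)).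
  ring.
by rewrite mV mul1r.
Qed.

End Pencil.

(** * Pencils whose ratio is injective on the projective line *)

Section Injective.
Variables (F : finFieldType) (f g : {poly F}).
Hypothesis oddF : odd #|F|.
Hypothesis fg_inj : forall P Q,
  form_at 3 f P * form_at 3 g Q = form_at 3 f Q * form_at 3 g P -> P = Q.

Let two0 : 2 != 0 :> F := odd_char_neq0 oddF.

Lemma exists_not_triple p : p \in [pchar F] ->
  ~ (poly_in_Xp p f /\ poly_in_Xp p g) ->
  exists u, forall c, g.[u] *: f - f.[u] *: g != c *: ('X - u%:P) ^+ 3.
Proof.
move=> charF insep; pose h u := g.[u] *: f - f.[u] *: g.
have [/existsP[u /forallP hu]|] :=
  boolP [exists u, [forall c, h u != c *: ('X - u%:P) ^+ 3]].
  by exists u.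
rewrite negb_exists => /forallP all3; case: insep.
have triple u : exists c, h u = c *: ('X - u%:P) ^+ 3.
  by have := all3 u; rewrite negb_forall => /existsP[c]; rewrite negbK => /eqP; exists c.
have [[c0 h0] [c1 h1] [c2 h2]] := And3 (triple 0) (triple 1) (triple (-1)).
pose W x y := f.[x] * g.[y] - f.[y] * g.[x].
have W0 x y : x != y -> W x y != 0.
  by apply: contra_neq => /eqP; rewrite subr_eq0 => /eqP;
     move=> /(fg_inj (P := Some x) (Q := Some y)) [].
have W01 : W 0 1 != 0 by rewrite W0 // eq_sym oner_eq0.
have W20 : W (-1) 0 != 0 by rewrite W0 // oppr_eq0 oner_eq0.
have c10 : c1 != 0.
  apply: contra_neq W01 => c10.
  have : (h 1).[0] = 0 by rewrite h1 c10 scale0r horner0.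
  by move=> h10; rewrite -[RHS]h10 /h /W hornerD hornerN !hornerZ; ring.
(* Each h u is a combination of f and g, so three of them satisfy this determinantal relation. *)
have rel : (W 1 (-1)) *: h 0 + (W (-1) 0) *: h 1 + (W 0 1) *: h (-1) = 0.
  rewrite /h /W; move: f.[0] f.[1] f.[-1] g.[0] g.[1] g.[-1] => f0 f1 f2 g0 g1 g2.
  by rewrite -!mul_polyC !(polyCB, polyCM); ring.
have three0 : 3 = 0 :> F.
  pose k0 := W 1 (-1) * c0; pose k1 := W (-1) 0 * c1; pose k2 := W 0 1 * c2.
  (* Expansion of k0 X^3 + k1 (X - 1)^3 + k2 (X + 1)^3. The two lowest coefficients give k1 = k2 and
     6 k1 = 0, with k1 nonzero. *)
  have E : (k0 + k1 + k2) *: 'X^3 + (3 * (k2 - k1)) *: 'X^2 + (3 * (k1 + k2)) *: 'X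
      + (k2 - k1)%:P = 0 :> {poly F}.
    rewrite -rel h0 h1 h2 !scalerA -/k0 -/k1 -/k2 -!mul_polyC.
    by rewrite !(polyCB, polyCD, polyCM, polyCN, polyC1, polyC0); ring.
  have E0 : k2 = k1.
    apply/eqP; rewrite -subr_eq0.
    by have /(congr1 (coefp 0)) := E; rewrite /coefp !coefE /= !(mulr0, add0r) => ->.
  have E1 : 3 * (k1 + k2) = 0.
    by have /(congr1 (coefp 1)) := E; rewrite /coefp !coefE /= !(mulr0, add0r, mulr1, addr0).
  apply: (mulIf (_ : 2 * k1 != 0)); first by rewrite !mulf_neq0.
  by rewrite mul0r -E1 E0; ring.
have p3 : p = 3%N.
  have : 3%N \in [pchar F] by rewrite inE /= three0.
  by rewrite (pcharf_eq charF) => /eqP.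
have span (s : {poly F}) : (W 0 1)^-1 *: (W 0 1 *: s) = s.
  by rewrite scalerA mulVf // scale1r.
(* As W(0, 1) is nonzero, h 0 and h 1 span the pencil; in characteristic 3 both are polynomials in
   X^3, hence so are f and g. *)
have fE : f = (W 0 1)^-1 *: (f.[0] *: h 1 - f.[1] *: h 0).
  rewrite -[LHS]span /h /W; congr (_ *: _).
  move: f.[0] f.[1] g.[0] g.[1] => f0 f1 g0 g1.
  by rewrite -!mul_polyC !(polyCB, polyCM); ring.
have gE : g = (W 0 1)^-1 *: (g.[0] *: h 1 - g.[1] *: h 0).
  rewrite -[LHS]span /h /W; congr (_ *: _).
  move: f.[0] f.[1] g.[0] g.[1] => f0 f1 g0 g1.
  by rewrite -!mul_polyC !(polyCB, polyCM); ring.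
have h0E : h 0 = (c0 *: 'X) \Po 'X^3.
  by rewrite h0 subr0 comp_polyZ comp_polyX.
have h1E : h 1 = (c1 *: ('X - 1)) \Po 'X^3.
  rewrite h1 comp_polyZ comp_polyB comp_polyX comp_polyC; congr (_ *: _).
  transitivity ('X^3 - 1 + (3 : F)%:P * ('X - 'X^2) : {poly F}); first by ring.
  by rewrite three0 polyC0 mul0r addr0.
rewrite p3; split; [rewrite fE|rewrite gE];
  rewrite h0E h1E -!comp_polyZ -comp_polyB -comp_polyZ.
  by eexists.
by eexists.
Qed.

Section PencilAt.
Variables al be ga de e u A B C : F.
Let w := 'X - u%:P.
Let Z := 1 + e%:P * w.
Hypotheses (det : al * de - be * ga != 0) (B0 : B != 0).
Hypothesis EN : al *: f + be *: g = Z ^+ 3 + A%:P * Z * w ^+ 2 + C%:P * w ^+ 3.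
Hypothesis ED : ga *: f + de *: g = w * (B%:P * Z ^+ 2 + w ^+ 2).

(* [pt] is the inverse of the change of variable [z = Z / w]. *)
Let pt (z : F) : option F := if z == e then None else Some (u + (z - e)^-1).
(** The value at [pt z] of the linear form homogenizing w; at infinity, [1 : 0], it is 1. *)
Let sc (z : F) : F := if z == e then 1 else (z - e)^-1.

Let pt_inj : injective pt.
Proof.
move=> x y; rewrite /pt; case: eqVneq => [->|xe]; case: eqVneq => [->|ye] //.
by case=> /addrI/invr_inj/addIr.
Qed.

Let pt_neq z : pt z <> Some u.
Proof.
rewrite /pt; case: eqVneq => // ze [] /eqP.
by rewrite -[X in _ == X]addr0 (inj_eq (addrI u)) invr_eq0 subr_eq0 (negPf ze).
Qed.

Let numE z : al * form_at 3 f (pt z) + be * form_at 3 g (pt z) =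
  (z ^+ 3 + A * z + C) * sc z ^+ 3.
Proof.
rewrite -!form_atZ -form_atD EN /pt /sc.
case: eqVneq => [->|ze] /=.
  rewrite expr1n mulr1.
  (* At z = e the point is infinity, where only the coefficient of X^3 counts. *)
  have -> : Z ^+ 3 + A%:P * Z * w ^+ 2 + C%:P * w ^+ 3 =
    (e ^+ 3 + A * e + C) *: 'X^3
    + (3 * e ^+ 2 * (1 - e * u) + A * (1 - e * u - 2 * e * u)
       - 3 * C * u) *: 'X^2
    + (3 * e * (1 - e * u) ^+ 2 + A * (e * u ^+ 2 - 2 * u * (1 - e * u))
       + 3 * C * u ^+ 2) *: 'X
    + ((1 - e * u) ^+ 3 + A * (1 - e * u) * u ^+ 2 - C * u ^+ 3)%:P.
    rewrite /Z /w -!mul_polyC.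
    by rewrite !(polyCB, polyCD, polyCM, polyCN, polyC_exp, polyC1); ring.
  by rewrite !coefE /= !(mulr0, addr0, mulr1).
rewrite /Z /w !(hornerD, hornerN, hornerM, horner_exp, hornerX, hornerC).
by field; rewrite subr_eq0.
Qed.

Let denE z : ga * form_at 3 f (pt z) + de * form_at 3 g (pt z) =
  (B * z ^+ 2 + 1) * sc z ^+ 3.
Proof.
rewrite -!form_atZ -form_atD ED /pt /sc.
case: eqVneq => [->|ze] /=.
  rewrite expr1n mulr1.
  have -> : w * (B%:P * Z ^+ 2 + w ^+ 2) =
    (B * e ^+ 2 + 1) *: 'X^3
    + (B * (2 * e * (1 - e * u) - e ^+ 2 * u) - 3 * u) *: 'X^2
    + (B * ((1 - e * u) ^+ 2 - 2 * e * u * (1 - e * u)) + 3 * u ^+ 2) *: 'X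
    + (- u * (B * (1 - e * u) ^+ 2 + u ^+ 2))%:P.
    rewrite /Z /w -!mul_polyC.
    by rewrite !(polyCB, polyCD, polyCM, polyCN, polyC_exp, polyC1); ring.
  by rewrite !coefE /= !(mulr0, addr0, mulr1).
rewrite /Z /w !(hornerD, hornerN, hornerM, horner_exp, hornerX, hornerC).
by field; rewrite subr_eq0.
Qed.

(** At a zero z, the second member of the pencil would vanish at both [pt z] and u, which
    injectivity forbids. *)
Lemma pencil_den_irr z : B * z ^+ 2 + 1 != 0.
Proof.
apply/eqP => Bz; apply: (@pt_neq z); apply: fg_inj.
have Dz : ga * form_at 3 f (pt z) + de * form_at 3 g (pt z) = 0.
  by rewrite denE Bz mul0r.
have Du : ga * form_at 3 f (Some u) + de * form_at 3 g (Some u) = 0.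
  rewrite -!form_atZ -form_atD ED /w /=.
  by rewrite hornerM hornerXsubC subrr mul0r.
move: Dz Du; set fz := form_at 3 f (pt z); set gz := form_at 3 g (pt z).
set fu := form_at 3 f (Some u); set gu := form_at 3 g (Some u) => Dz Du.
apply: (mulIf det); apply/eqP; rewrite -subr_eq0; apply/eqP.
transitivity ((al * fz + be * gz) * (ga * fu + de * gu) 
  - (al * fu + be * gu) * (ga * fz + de * gz)) ; first by ring.
by rewrite Dz Du !mulr0 subrr.
Qed.

Let psi z := (z ^+ 3 + A * z + C) / (B * z ^+ 2 + 1).

(** In the coordinate z, psi is f / g followed by the invertible map with coefficients al, be, ga,
    de. *)
Let psi_inj : injective psi.
Proof.
move=> x y /eqP; rewrite eqr_div ?pencil_den_irr // => /eqP E.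
apply: pt_inj; apply: fg_inj.
have := numE x; have := numE y; have := denE x; have := denE y.
set fx := form_at 3 f (pt x); set gx := form_at 3 g (pt x).
set fy := form_at 3 f (pt y); set gy := form_at 3 g (pt y) => Dy Dx Ny Nx.
apply: (mulIf det); apply/eqP; rewrite -subr_eq0; apply/eqP.
transitivity ((al * fx + be * gx) * (ga * fy + de * gy) 
  - (al * fy + be * gy) * (ga * fx + de * gx)) ; first by ring.
rewrite Dx Dy Nx Ny; move: E; move: (x ^+ 3 + A * x + C) => nx.
by move: (B * y ^+ 2 + 1) => dy E; rewrite mulrACA E; ring.
Qed.

Lemma pencil_const_eq0 : C = 0.
Proof.
have S1 := sum_inv_quadratic oddF B0 pencil_den_irr.
have sum0 : \sum_z psi z = 0.
  rewrite -[RHS](sum_odd_eq0 oddF (h := id)) //.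
  by apply/esym; apply: (reindex_inj psi_inj).
have E : \sum_z psi z = \sum_z (z ^+ 3 + A * z) / (B * z ^+ 2 + 1) +
    C * \sum_z (B * z ^+ 2 + 1)^-1.
  by rewrite mulr_sumr -big_split; apply: eq_bigr => z _; rewrite /psi mulrDl.
move: E; rewrite sum0 (sum_odd_eq0 oddF) ?add0r => [E|z]; last first.
  by rewrite sqrrN -mulNr; congr (_ / _); ring.
by rewrite -[C]mulr1 -S1 mulrCA -E mulr0.
Qed.

(** If A B = 1 and C = 0, the first member is A Z (B Z^2 + w^2), so the quadratic B Z^2 + w^2
    divides both members and is constant; but its X^2 coefficient B e^2 + 1 is nonzero. *)
Lemma pencil_coprime : coprimep f g -> C = 0 -> A * B != 1.
Proof.
move=> cfg C0; apply/eqP => AB1.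
have K2 : (B%:P * Z ^+ 2 + w ^+ 2)`_2 = B * e ^+ 2 + 1.
  have -> : B%:P * Z ^+ 2 + w ^+ 2 = (B * e ^+ 2 + 1) *: 'X^2 +
    (2 * (B * e * (1 - e * u) - u)) *: 'X + (B * (1 - e * u) ^+ 2 + u ^+ 2)%:P.
    rewrite /Z /w -!mul_polyC.
    by rewrite !(polyCB, polyCD, polyCM, polyCN, polyC_exp, polyC1); ring.
  by rewrite !coefE /= !(mulr0, addr0, mulr1).
suff s1 : size (B%:P * Z ^+ 2 + w ^+ 2) = 1%N.
  by have /eqP[] := pencil_den_irr e; rewrite -K2 nth_default // s1.
apply: (coprime_pencil_divisor det cfg); last by rewrite ED dvdp_mull.
have -> : al *: f + be *: g = A%:P * Z * (B%:P * Z ^+ 2 + w ^+ 2).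
  transitivity ((A * B)%:P * Z ^+ 3 + A%:P * Z * w ^+ 2 : {poly F}).
    by rewrite EN C0 AB1 polyC0 mul0r addr0 mul1r.
  by rewrite polyCM; ring.
exact: dvdp_mull.
Qed.

End PencilAt.
End Injective.

(** * Classification of the cubic permutation functions *)

Lemma cubic_normal_form (F : finFieldType) (p : nat) (phi : ratfun F) :
  p \in [pchar F] -> odd #|F| ->
  ratfun_separable p phi -> permutation_ratfun phi ->
  ratfun_degree phi = 3%N ->
  exists a b : F, b != 0 /\ ratfun_equiv phi (cubic_ratfun a b).
Proof.
move=> charF oddF sep /permutation_ratfunP /ratfun_eval_inj inj deg3.
have two0 := odd_char_neq0 oddF; have cfg := ratfun_coprime phi.
rewrite /= deg3 in inj.
have [u hu] := exists_not_triple oddF inj charF sep.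
have [sf sg] : (size (ratfun_num phi) <= 4)%N /\ (size (ratfun_den phi) <= 4)%N.
  move: deg3; rewrite /ratfun_degree; lia.
have fgu : ((ratfun_num phi).[u] != 0) || ((ratfun_den phi).[u] != 0).
  exact: (form_at_neq0 (Some u) cfg).
have [] := pencil_normal_form two0 sf sg fgu _ _ hu.
(* A vanishing X^3 coefficient would give infinity and u the same value under phi; likewise for
   another root x below. *)
- rewrite coefB !coefZ subr_eq0; apply/eqP => E.
  suff : Some u = None by [].
  by apply: inj; rewrite /= -E mulrC.
- move=> x; apply: contra_neq; rewrite hornerD hornerN !hornerZ => /eqP.
  rewrite subr_eq0 => /eqP E.
  suff [] : Some x = Some u by [].
  by apply: inj; rewrite /= mulrC E.
move=> al [be [ga [de [e [A [B [C [det B0 EN ED]]]]]]]].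
have C0 := pencil_const_eq0 oddF inj det B0 EN ED.
have AB1 := pencil_coprime inj det EN ED cfg C0.
exists A, B; split=> //.
apply: (equiv_of_pencil det B0 AB1 deg3 _ ED).
by rewrite EN C0 polyC0 mul0r addr0.
Qed.

Theorem theorem5p1 (F : finFieldType) (p : nat)
  (charF : p \in [pchar F]) (oddF : odd #|F|) :
  (forall phi : ratfun F,
     ratfun_separable p phi -> permutation_ratfun phi ->
     ratfun_degree phi = 3%N ->
     exists a b : F, b != 0 /\ ratfun_equiv phi (cubic_ratfun a b)) /\
  (forall a b : F, b != 0 ->
     (ratfun_degree (cubic_ratfun a b) = 3%N /\
      permutation_ratfun (cubic_ratfun a b)) <->
     (~ is_square (- b) /\ a * b = 9%:R)).
Proof.
split=> [phi sep perm deg3|a b b0].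
  exact: cubic_normal_form charF oddF sep perm deg3.
split=> [[/(cubic_degree a b0) ab1 /permutation_ratfunP] | [nsq ab9]].
  exact: cubic_ratfun_inj_cond.
have two0 := odd_char_neq0 oddF; split.
  apply/cubic_degree => //; rewrite ab9 -subr_eq0.
  rewrite (_ : 9 - 1 = 2 ^+ 3 :> F); last by ring.
  by rewrite expf_neq0.
by apply/permutation_ratfunP; exact: cubic_ratfun_inj.
Qed.
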